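(* Let $\Gamma$ be a conservative valued constraint language on a finite domain $D$ such that $G_\Gamma$ has no soft self-loop. Define ternary operations $\mathrm{Mj}_1,\mathrm{Mj}_2,\mathrm{Mn}_3$ on $D$ by setting $(\mathrm{Mj}_1,\mathrm{Mj}_2,\mathrm{Mn}_3)(x,y,z)$ equal to: $(x,y,z)$ if [$x=y$ and $(y,z)\in\overline{M}$] or $xy|z$; $(z,x,y)$ if [$z=x$ and $(x,y)\in\overline{M}$] or $zx|y$; $(y,z,x)$ if [$y=z$ and $(z,x)\in\overline{M}$] or $yz|x$; and $(x,y,z)$ otherwise. Then $\langle\mathrm{Mj}_1,\mathrm{Mj}_2,\mathrm{Mn}_3\rangle$ is a multimorphism of $\Gamma$.
   Context: A weighted relation of arity $r$ on $D$ is a map $D^r\to\mathbb{Q}\cup\{\infty\}$; a relation has values in $\{0,\infty\}$ and is identified with the set of tuples mapped to $0$. $\mathrm{Feas}(\gamma)=\{\mathbf{x}:\gamma(\mathbf{x})<\infty\}$, $\mathrm{Opt}(\gamma)$ is the relation of tuples in $\mathrm{Feas}(\gamma)$ of minimum value. $\Gamma$ is conservative if it contains all unary weighted relations $D\to\{0,1\}$. $\mathcal{C}(\Gamma)$ is the smallest set of weighted relations on $D$ containing $\Gamma$, all unary weighted relations on $D$ and the binary equality relation on $D$, and closed under: $\mathrm{Feas}$ and $\mathrm{Opt}$; adding a unary weighted relation $\mu$ at a coordinate $i$ ($\gamma'(\mathbf{x})=\gamma(\mathbf{x})+\mu(x_i)$); minimisation at a coordinate; and join of binary $\gamma_1,\gamma_2$: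 $\gamma(x,y)=\min_{z\in D}(\gamma_1(u_1,v_1)+\gamma_2(u_2,v_2))$ with $\{u_1,v_1\}=\{x,z\}$, $\{u_2,v_2\}=\{y,z\}$ (either order). $G_\Gamma$ is the undirected graph (self-loops allowed) on vertices $(a,b)\in D^2$, $a\ne b$, with an edge $(a_1,b_1)-(a_2,b_2)$ iff there is a binary $\gamma\in\mathcal{C}(\Gamma)$ with $(a_1,b_2),(b_1,a_2)\in\mathrm{Feas}(\gamma)$ and $\gamma(a_1,b_2)+\gamma(b_1,a_2)<\gamma(a_1,a_2)+\gamma(b_1,b_2)$; the edge is soft if some such $\gamma$ also has at least one of $(a_1,a_2),(b_1,b_2)$ in $\mathrm{Feas}(\gamma)$. $\overline{M}$ is the set of vertices with a self-loop. For $a,b,c\in D$, ''$ab|c$ holds'' means $a,b,c$ are pairwise distinct and there exists $(s,t)\in\overline{M}$ such that the binary relation $\{(a,s),(b,s),(c,t)\}$ belongs to $\mathcal{C}(\Gamma)$. Operations act on tuples componentwise. A list $\langle f_1,..,f_k\rangle$ of $k$-ary operations is a multimorphism of $\gamma$ if for all $\mathbf{x}^1,..,\mathbf{x}^k\in\mathrm{Feas}(\gamma)$ each $f_i(\mathbf{x}^1,..,\mathbf{x}^k)\in\mathrm{Feas}(\gamma)$ and $\sum_i\gamma(f_i(\mathbf{x}^1,..,\mathbf{x}^k))\le\sum_i\gamma(\mathbf{x}^i)$; it is a multimorphism of $\Gamma$ if it is one of every $\gamma\in\Gamma$. *)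

(* Defs.v *)
From HB Require Import structures.
From mathcomp Require Import all_boot all_order all_algebra.
From mathcomp Require Import boolp.

Set Implicit Arguments.
Unset Strict Implicit.
Unset Printing Implicit Defensive.

Import Order.TTheory GRing.Theory Num.Theory.
Local Open Scope ring_scope.

(** Q u {oo}, with [None] for oo. *)
Definition qinf : Type := option rat.

HB.instance Definition _ := Choice.on qinf.

Definition fin (q : rat) : qinf := Some q.
Definition infty : qinf := None.

Definition qinf_add (x y : qinf) : qinf :=
  match x, y with Some p, Some q => Some (p + q) | _, _ => None end.

Definition qinf_le (x y : qinf) : bool :=
  match x, y with
  | Some p, Some q => p <= q
  | _, None => true
  | None, Some _ => false
  end.

Fact qinf_addA : associative qinf_add.
Proof. by move=> [p|] [q|] [r|] //=; rewrite addrA. Qed.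

Fact qinf_addC : commutative qinf_add.
Proof. by move=> [p|] [q|] //=; rewrite addrC. Qed.

Fact qinf_add0 : left_id (fin 0) qinf_add.
Proof. by move=> [p|] //=; rewrite add0r. Qed.

HB.instance Definition _ :=
  GRing.isNmodule.Build qinf qinf_addA qinf_addC qinf_add0.

Fact qinf_le_refl : reflexive qinf_le.
Proof. by move=> [p|] /=. Qed.

Fact qinf_le_anti : antisymmetric qinf_le.
Proof. by move=> [p|] [q|] //= /le_anti ->. Qed.

Fact qinf_le_trans : transitive qinf_le.
Proof. by move=> [p|] [q|] [r|] //=; apply: le_trans. Qed.

HB.instance Definition _ :=
  Order.Le_isPOrder.Build ring_display qinf
    qinf_le_refl qinf_le_anti qinf_le_trans.

Fact qinf_le_total : total (<=%R : rel qinf).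
Proof. by move=> [p|] [q|] //=; apply: (le_total p q). Qed.

HB.instance Definition _ :=
  Order.POrder_isTotal.Build ring_display qinf qinf_le_total.

Section WeightedRelations.
Variable D : finType.

(** [{ffun _ -> _}] rather than plain functions, so that equality of weighted
    relations is extensional. *)
Definition wrel (r : nat) : Type := {ffun r.-tuple D -> qinf}.

Definition wrel_of_rel r (R : {set r.-tuple D}) : wrel r :=
  [ffun x => if x \in R then fin 0 else infty].

Definition feas r (g : wrel r) : {set r.-tuple D} := [set x | g x < infty].

Definition opt r (g : wrel r) : {set r.-tuple D} :=
  [set x in feas g | [forall y, g x <= g y]].

Definition eqrel : wrel 2 :=
  wrel_of_rel [set x : 2.-tuple D | tnth x ord0 == tnth x ord_max].

Definition add_unary r (g : wrel r) (mu : wrel 1) (i : 'I_r) : wrel r :=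
  [ffun x => g x + mu [tuple tnth x i]].

Definition insert r (i : 'I_r.+1) (a : D) (x : r.-tuple D) : r.+1.-tuple D :=
  [tuple if unlift i j is Some k then tnth x k else a | j < r.+1].

Definition minimise r (g : wrel r.+1) (i : 'I_r.+1) : wrel r :=
  [ffun x => \big[Order.min/infty]_(a : D) g (insert i a x)].

Definition orient (b : bool) (x z : D) : 2.-tuple D :=
  if b then [tuple z; x] else [tuple x; z].

Definition join (b1 b2 : bool) (g1 g2 : wrel 2) : wrel 2 :=
  [ffun p => \big[Order.min/infty]_(z : D)
     (g1 (orient b1 (tnth p ord0) z) + g2 (orient b2 (tnth p ord_max) z))].

Definition language : Type := forall r, wrel r -> Prop.

Definition conservative (G : language) : Prop :=
  forall mu : wrel 1, (forall x, mu x = fin 0 \/ mu x = fin 1) -> G 1%N mu.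

Inductive closure (G : language) : language :=
  | closure_base r (g : wrel r) : G r g -> closure G g
  | closure_unary (mu : wrel 1) : closure G mu
  | closure_eq : closure G eqrel
  | closure_feas r (g : wrel r) : closure G g -> closure G (wrel_of_rel (feas g))
  | closure_opt r (g : wrel r) : closure G g -> closure G (wrel_of_rel (opt g))
  | closure_add_unary r (g : wrel r) (mu : wrel 1) (i : 'I_r) :
      closure G g -> closure G (add_unary g mu i)
  | closure_minimise r (g : wrel r.+1) (i : 'I_r.+1) :
      closure G g -> closure G (minimise g i)
  | closure_join b1 b2 (g1 g2 : wrel 2) :
      closure G g1 -> closure G g2 -> closure G (join b1 b2 g1 g2).

Definition is_vertex (v : D * D) : bool := v.1 != v.2.

Definition edge_witness (v w : D * D) (g : wrel 2) : Prop :=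
  [/\ [tuple v.1; w.2] \in feas g, [tuple v.2; w.1] \in feas g &
      g [tuple v.1; w.2] + g [tuple v.2; w.1]
        < g [tuple v.1; w.1] + g [tuple v.2; w.2]].

Definition edge (G : language) (v w : D * D) : Prop :=
  [/\ is_vertex v, is_vertex w &
      exists2 g : wrel 2, closure G g & edge_witness v w g].

Definition soft_edge (G : language) (v w : D * D) : Prop :=
  [/\ is_vertex v, is_vertex w &
      exists g : wrel 2, [/\ closure G g, edge_witness v w g &
        [tuple v.1; w.1] \in feas g \/ [tuple v.2; w.2] \in feas g]].

Definition no_soft_self_loop (G : language) : Prop :=
  forall v, ~ soft_edge G v v.

Definition Mbar (G : language) (v : D * D) : Prop := edge G v v.

(** "ab|c holds" *)
Definition bar (G : language) (a b c : D) : Prop :=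
  uniq [:: a; b; c] /\
  exists s t, Mbar G (s, t) /\
    closure G (wrel_of_rel [set [tuple a; s]; [tuple b; s]; [tuple c; t]]).

(** [apply_op f X] applies [f] componentwise to the rows of [X]. *)
Definition apply_op k r (f : k.-tuple D -> D) (X : k.-tuple (r.-tuple D)) :
    r.-tuple D :=
  [tuple f [tuple tnth (tnth X i) j | i < k] | j < r].

Definition multimorphism_of k (F : k.-tuple (k.-tuple D -> D)) r (g : wrel r) :
    Prop :=
  forall X : k.-tuple (r.-tuple D), (forall i, tnth X i \in feas g) ->
    (forall i, apply_op (tnth F i) X \in feas g) /\
    \sum_(i < k) g (apply_op (tnth F i) X) <= \sum_(i < k) g (tnth X i).

Definition multimorphism k (F : k.-tuple (k.-tuple D -> D)) (G : language) :
    Prop :=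
  forall r (g : wrel r), G r g -> multimorphism_of F g.

Definition op3 (f : D -> D -> D -> D) (t : 3.-tuple D) : D :=
  f (tnth t (@Ordinal 3 0 isT)) (tnth t (@Ordinal 3 1 isT))
    (tnth t (@Ordinal 3 2 isT)).

(** The cases are tried in order, the first one that applies being taken. *)
Definition MJN (G : language) (x y z : D) : D * D * D :=
  if `[< (x = y /\ Mbar G (y, z)) \/ bar G x y z >] then (x, y, z)
  else if `[< (z = x /\ Mbar G (x, y)) \/ bar G z x y >] then (z, x, y)
  else if `[< (y = z /\ Mbar G (z, x)) \/ bar G y z x >] then (y, z, x)
  else (x, y, z).

Definition Mj1 (G : language) (x y z : D) : D := (MJN G x y z).1.1.
Definition Mj2 (G : language) (x y z : D) : D := (MJN G x y z).1.2.
Definition Mn3 (G : language) (x y z : D) : D := (MJN G x y z).2.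

End WeightedRelations.

(* Main.v *)
(** Let [Mbar (c, d)] hold. Composing a binary weighted relation [g] of the
    closure with [{(c, d), (d, c)}] and the transpose of [g] shows that [(c, d)]
    has no soft edge at all, so [g] is modular on any 2 x 2 rectangle
    [{a, b} * {c, d}] whose main diagonal and at least one other corner are
    feasible. By induction on the Hamming distance this lifts to tuples: if [u]
    and [v] are feasible, all [(u_j, v_j)] with [u_j <> v_j], [j] in [S], lie in
    [Mbar], and for each [i] outside and [j] inside [S] where [u] and [v] differ
    one of [(u_i, v_j)], [(v_i, u_j)] is a projection of a feasible tuple, then
    [u] and [v] may swap their [S]-parts without changing the sum of values.

    Let [Px], [Py] be the sets of coordinates where [yz|x], resp. [zx|y], holds
    (in the extended sense of [cut]). The operations are obtained by swapping [x]
    and [y] on [Px] and [Py], then the first result and [z] on [Py], then the two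
    other results on [Px]. The projections required for these swaps exist since
    otherwise pulling [yz|x] back from [j] to [i] would put [i] into [Px]. *)

From mathcomp Require Import all_boot all_order all_algebra.
From mathcomp Require Import boolp lra.
Require Import Defs.

Set Implicit Arguments.
Unset Strict Implicit.
Unset Printing Implicit Defensive.

Import Order.TTheory GRing.Theory Num.Theory.
Local Open Scope ring_scope.

(** * Order and sums in the rationals extended by infinity *)

Lemma qinf_ltE (x y : qinf) :
  (x < y) = match x, y with
            | Some p, Some q => p < q
            | Some _, None => true
            | None, _ => false
            end.
Proof.
by case: x y => [p|] [q|]; rewrite !lt_def //=.
Qed.

Lemma lt_inftyE (x : qinf) : (x < infty) = isSome x.
Proof. by rewrite qinf_ltE; case: x. Qed.

Lemma le_infty_eq (x : qinf) : infty <= x -> x = infty.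
Proof. by case: x. Qed.

Lemma sum_fin (I : Type) (s : seq I) (f : I -> rat) :
  \sum_(i <- s) (fin (f i)) = fin (\sum_(i <- s) f i).
Proof. by elim: s => [|i s IH]; rewrite ?big_nil // !big_cons IH. Qed.

Lemma qinf_add_eq_fin (x y : qinf) q :
  x + y = fin q -> exists x' y', [/\ x = fin x', y = fin y' & x' + y' = q].
Proof. by case: x y => [x|] [y|] // [<-]; exists x, y. Qed.

(** * Minima over the finite domain *)

Section BigMin.
Variables (D : finType) (f : D -> qinf).
Let m := \big[Order.min/infty]_(a : D) f a.

Lemma bigmin_infty_le a : m <= f a.
Proof.
rewrite /m; have: a \in index_enum D by rewrite mem_index_enum.
elim: (index_enum D) => [//|b s IH]; rewrite inE big_cons ge_min.
by case/orP => [/eqP->|/IH->]; rewrite ?lexx ?orbT.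
Qed.

Lemma bigmin_infty_attained : m = infty \/ exists a, m = f a.
Proof.
rewrite /m; elim: (index_enum D) => [|b s IH]; first by left; rewrite big_nil.
rewrite big_cons minEle; case: ifP => _ //; by right; exists b.
Qed.

Lemma bigmin_inftyP q : m = fin q -> exists a, f a = fin q.
Proof. by case: bigmin_infty_attained => [->//|[a ->]]; exists a. Qed.

Lemma bigmin_infty_single c : (forall z, z != c -> f z = infty) -> m = f c.
Proof.
move=> H; have := bigmin_infty_le c.
case: bigmin_infty_attained => [->/le_infty_eq-> //|[a ->]].
by have [->//|/H ->/le_infty_eq ->] := eqVneq a c.
Qed.

Lemma bigmin_infty_pair c d :
  (forall z, z != c -> z != d -> f z = infty) -> m = Order.min (f c) (f d).
Proof.
move=> H; apply/le_anti; rewrite le_min !bigmin_infty_le /=.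
case: bigmin_infty_attained => [->|[a ->]]; first by case: Order.min.
have [->|/H Hc] := eqVneq a c; first by rewrite ge_min lexx.
have [->|/Hc ->] := eqVneq a d; first by rewrite ge_min lexx orbT.
by case: Order.min.
Qed.

End BigMin.

(** * Restriction, transposition and projection inside the closure *)

Section Closure.
Variables (D : finType) (G : language D).

Lemma feasP r (g : wrel D r) p : reflect (exists q, g p = fin q) (p \in feas g).
Proof.
rewrite inE lt_inftyE; case: (g p) => [q|] /=; constructor.
  by exists q.
by case.
Qed.

Lemma feas_wrel_of_rel r (R : {set r.-tuple D}) : feas (wrel_of_rel R) = R.
Proof. by apply/setP => p; rewrite inE lt_inftyE ffunE; case: ifP. Qed.

Lemma tnth2_0 (x y : D) : tnth [tuple x; y] ord0 = x.
Proof. by []. Qed.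

Lemma tnth2_1 (x y : D) : tnth [tuple x; y] ord_max = y.
Proof. by []. Qed.

Lemma tuple2E (p : 2.-tuple D) : p = [tuple tnth p ord0; tnth p ord_max].
Proof.
apply: eq_from_tnth => -[[|[|//]] Hi].
  by rewrite (_ : Ordinal Hi = ord0) ?tnth2_0 //; apply: val_inj.
by rewrite (_ : Ordinal Hi = ord_max) ?tnth2_1 //; apply: val_inj.
Qed.

Lemma tuple2_eq (a b c d : D) :
  ([tuple a; b] == [tuple c; d]) = (a == c) && (b == d).
Proof. by rewrite -val_eqE /= !eqseq_cons andbT. Qed.

Lemma joinE b1 b2 (g1 g2 : wrel D 2) x y :
  join b1 b2 g1 g2 [tuple x; y] =
  \big[Order.min/infty]_(z : D) (g1 (orient b1 x z) + g2 (orient b2 y z)).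
Proof. by rewrite ffunE. Qed.

Lemma feas_join b1 b2 (g1 g2 : wrel D 2) x y :
  [tuple x; y] \in feas (join b1 b2 g1 g2) <->
  exists z, orient b1 x z \in feas g1 /\ orient b2 y z \in feas g2.
Proof.
split=> [/feasP[q]|[z [/feasP[q1 E1] /feasP[q2 E2]]]].
  rewrite joinE => /bigmin_inftyP[z /qinf_add_eq_fin[q1 [q2 [E1 E2 _]]]].
  by exists z; split; apply/feasP; [exists q1|exists q2].
rewrite inE joinE; apply: le_lt_trans (bigmin_infty_le _ z) _.
by rewrite E1 E2 qinf_ltE.
Qed.

Definition indicator (A : {set D}) : wrel D 1 :=
  [ffun x => if tnth x ord0 \in A then fin 0 else infty].

Definition restrict (g : wrel D 2) (A B : {set D}) : wrel D 2 :=
  add_unary (add_unary g (indicator A) ord0) (indicator B) ord_max.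

Lemma closure_restrict g A B : closure G g -> closure G (restrict g A B).
Proof. by move=> Cg; do 2!apply: closure_add_unary. Qed.

Lemma restrictE g A B x y : restrict g A B [tuple x; y] =
  if (x \in A) && (y \in B) then g [tuple x; y] else infty.
Proof.
rewrite !ffunE tnth2_0 tnth2_1 /tnth /=.
by case: (x \in A); case: (y \in B); case: (g _) => [q|] //=; rewrite !addr0.
Qed.

Lemma feas_restrict g A B x y : ([tuple x; y] \in feas (restrict g A B)) =
  [&& x \in A, y \in B & [tuple x; y] \in feas g].
Proof.
rewrite !(inE, lt_inftyE) restrictE.
by case: (x \in A); case: (y \in B).
Qed.

(** Iterates [add_unary], so that a penalty separable over the coordinates can be added to [g]
    before projecting. *)
Lemma closure_weights r (g : wrel D r) (mu : 'I_r -> wrel D 1) :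
  closure G g ->
  closure G [ffun p => g p + \sum_k mu k [tuple tnth p k]].
Proof.
move=> Cg; elim: (index_enum _) => [|k s IH].
  rewrite (_ : finfun _ = g) //; apply/ffunP => p.
  by rewrite ffunE big_nil addr0.
rewrite (_ : finfun _ = add_unary [ffun p => g p +
  \sum_(k <- s) mu k [tuple tnth p k]] (mu k) k); last first.
  by apply/ffunP => p; rewrite !ffunE big_cons addrAC addrA.
exact: closure_add_unary.
Qed.

(** Minimum of [g] over all coordinates but [i] and [j], encoded as a lower bound that is attained
    whenever finite; this avoids a minimum over tuples. *)
Definition is_projection r (g : wrel D r) (i j : 'I_r) (h : wrel D 2) : Prop :=
  (forall p, h [tuple tnth p i; tnth p j] <= g p) /\
  (forall a b q, h [tuple a; b] = fin q ->
     exists p, [/\ tnth p i = a, tnth p j = b & g p = fin q]).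

(** In the join with equality only [z = b] contributes, and the flag on [g] reverses its
    arguments. *)
Lemma closure_transpose g : closure G g ->
  exists2 h, closure G h & forall a b, h [tuple a; b] = g [tuple b; a].
Proof.
move=> Cg; exists (join true true g (@eqrel D)).
  by apply: closure_join Cg (closure_eq _).
move=> a b; rewrite joinE (@bigmin_infty_single _ _ b) => [|z zb].
  by rewrite !ffunE inE tnth2_0 tnth2_1 (eqxx b) addr0.
by rewrite !ffunE inE tnth2_0 tnth2_1 (negPf zb) addrC.
Qed.

(** Induction on the arity: coordinates other than [i] and [j] are minimised away one at a time; at
    arity two, [h] is [g] or its transpose. *)
Lemma closure_projection r (g : wrel D r) (i j : 'I_r) :
  closure G g -> i != j -> exists2 h, closure G h & is_projection g i j h.
Proof.
elim: r g i j => [|r IH] g i j Cg ij; first by case: i {ij}.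
have [k /andP[ki kj]|none] := pickP [pred k | (k != i) && (k != j)].
  have [i' Ei _] := unlift_some ki; have [j' Ej _] := unlift_some kj.
  have ij' : i' != j' by apply: contraNneq ij => E; rewrite Ei Ej E.
  have [h Ch [h1 h2]] := IH _ _ _ (closure_minimise k Cg) ij'.
  exists h => //; split=> [p|a b q /h2[p [Ea Eb]]].
    have := h1 [tuple tnth p (lift k l) | l < r].
    rewrite !tnth_mktuple -Ei -Ej ffunE => /le_trans; apply.
    apply: le_trans (bigmin_infty_le _ (tnth p k)) _.
    rewrite (_ : insert _ _ _ = p) //; apply: eq_from_tnth => l.
    rewrite tnth_mktuple; case: unliftP => [l' ->|-> //].
    by rewrite tnth_mktuple.
  rewrite ffunE => /bigmin_inftyP[c E]; exists (insert k c p).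
  by rewrite Ei Ej !tnth_mktuple !liftK.
(* No third coordinate is left, so [i] and [j] exhaust the index set. *)
have Er : r.+1 = 2%N.
  rewrite -[LHS]card_ord -[2%N]/((true).+1) -ij -cards2 -cardsT.
  congr #|pred_of_set _|; apply/setP => l; rewrite !inE.
  by have /= := none l; case: eqP; case: eqP.
case: Er => Er; subst r.
have cases (l : 'I_2) : l = ord0 \/ l = ord_max.
  by case: l => -[|[|//]] Hl; [left|right]; apply: val_inj.
case: (cases i) (cases j) ij => -> [] -> // _.
  exists g => //; split=> [p|a b q E]; first by rewrite -tuple2E.
  by exists [tuple a; b]; rewrite tnth2_0 tnth2_1.
have [h Ch Eh] := closure_transpose Cg.
exists h => //; split=> [p|a b q]; rewrite Eh; first by rewrite -tuple2E.
by exists [tuple b; a]; rewrite tnth2_0 tnth2_1.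
Qed.

Lemma tuple2_ind (P : 2.-tuple D -> Prop) :
  (forall x y, P [tuple x; y]) -> forall p, P p.
Proof. by move=> H p; rewrite [p]tuple2E. Qed.

Lemma closure_wrel_of_feas (g : wrel D 2) (R : {set 2.-tuple D}) : closure G g ->
  (forall x y, ([tuple x; y] \in feas g) = ([tuple x; y] \in R)) ->
  closure G (wrel_of_rel R).
Proof.
move=> Cg E; rewrite (_ : R = feas g); first exact: closure_feas.
by apply/esym/setP; apply: tuple2_ind => x y; rewrite E.
Qed.

(** * Self-loops and modularity in the absence of soft self-loops *)

Hypothesis hsoft : no_soft_self_loop G.

Lemma Mbar_sym a b : Mbar G (a, b) -> Mbar G (b, a).
Proof.
case=> ab _ [g Cg [F1 F2 L]]; split; rewrite /is_vertex /= 1?eq_sym //.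
by exists g => //; split; rewrite //= addrC [ltRHS]addrC.
Qed.

Lemma Mbar_neq a b : Mbar G (a, b) -> a != b.
Proof. by case. Qed.

(** With [(a, a)] infeasible the diagonal sum is infinite, so the strict inequality required of a
    self-loop is automatic. *)
Lemma feas_Mbar a b (g : wrel D 2) : closure G g -> a != b ->
  [tuple a; b] \in feas g -> [tuple b; a] \in feas g ->
  [tuple a; a] \notin feas g -> Mbar G (a, b).
Proof.
move=> Cg ab Fab Fba Naa; split=> //; exists g => //; split=> //=.
move: Fab Fba Naa => /feasP[q1 ->] /feasP[q2 ->].
by rewrite inE lt_inftyE; case: (g [tuple a; a]).
Qed.

(** As the loop is not soft, its witness has both diagonal pairs infeasible; restricted to [a] and
    [b], only the two mixed pairs remain. *)
Lemma closure_neq a b : Mbar G (a, b) ->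
  closure G (wrel_of_rel [set [tuple a; b]; [tuple b; a]]).
Proof.
move=> [ab _ [g Cg W]]; have [/= F1 F2 _] := W; rewrite /is_vertex /= in ab.
have Naa : [tuple a; a] \notin feas g.
  by apply/negP => F; apply: (hsoft (v := (a, b))); split=> //; exists g; split; try left.
have Nbb : [tuple b; b] \notin feas g.
  by apply/negP => F; apply: (hsoft (v := (a, b))); split=> //; exists g; split; try right.
apply: (closure_wrel_of_feas (closure_restrict [set a; b] [set a; b] Cg)) => x y.
rewrite feas_restrict !in_set2 !tuple2_eq.
have [->|xa] /= := eqVneq x a; have [->|ya] //= := eqVneq y a.
- by rewrite (negPf ab) (negPf Naa) ?andbF.
- by rewrite (negPf ab) andbF orbF; case: eqP => //= ->.
- by rewrite andbT; case: eqP => //= ->.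
- by rewrite !andbF /=; case: eqP => //= ->; case: eqP => //= ->; rewrite (negPf Nbb).
Qed.

(* The relation [{(c, d), (d, c)}] turns an edge [v - (c, d)] into a self-loop
   at [v]: compose [g], this relation and the transpose of [g]. *)
Lemma Mbar_no_soft_edge v w : Mbar G w -> ~ soft_edge G v w.
Proof.
case: v w => a b [c d] Mcd [/= ab cd [g [Cg /= W soft]]].
set n := wrel_of_rel [set [tuple c; d]; [tuple d; c]].
have Cn : closure G n by apply: closure_neq.
rewrite /is_vertex /= in ab cd.
(* [g1] is [g] with columns [c] and [d] interchanged and all others infinite; [g2] composes it with
   the transpose of [g]. *)
pose g1 := join false false g n; pose g2 := join false false g1 g.
have Cg1 : closure G g1 by apply: closure_join.
have Cg2 : closure G g2 by apply: closure_join.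
have g1c x : g1 [tuple x; c] = g [tuple x; d].
  rewrite /g1 joinE (@bigmin_infty_single _ _ d) => [|z zd] /=.
    by rewrite ffunE !inE !tuple2_eq (eqxx c) (eqxx d) addr0.
  rewrite ffunE !inE !tuple2_eq (negPf zd) (negPf cd) andbF /=.
  by case: (g _).
have g1d x : g1 [tuple x; d] = g [tuple x; c].
  rewrite /g1 joinE (@bigmin_infty_single _ _ c) => [|z zd] /=.
    by rewrite ffunE !inE !tuple2_eq (eqxx c) (eqxx d) orbT addr0.
  rewrite ffunE !inE !tuple2_eq (negPf zd) (eq_sym d) (negPf cd) andbF /=.
  by case: (g _).
have g1x x z : z != c -> z != d -> g1 [tuple x; z] = infty.
  move=> zc zd; rewrite /g1 joinE (@bigmin_infty_single _ _ c) => [|y _] /=.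
    by rewrite ffunE !inE !tuple2_eq (negPf zc) (negPf zd); case: (g _).
  by rewrite ffunE !inE !tuple2_eq (negPf zc) (negPf zd); case: (g _).
have g2E x y : g2 [tuple x; y] =
    Order.min (g [tuple x; d] + g [tuple y; c]) (g [tuple x; c] + g [tuple y; d]).
  rewrite /g2 joinE (@bigmin_infty_pair _ _ c d) ?g1c ?g1d //.
  by move=> z zc zd /=; rewrite g1x.
case: W => /= /feasP[q1 E1] /feasP[q2 E2]; rewrite E1 E2 => lt.
have leab : fin q1 + fin q2 <= g [tuple a; c] + g [tuple b; d] by apply: ltW.
have Eab : g2 [tuple a; b] = fin (q1 + q2).
  by rewrite g2E E1 E2; apply: min_l.
have Eba : g2 [tuple b; a] = fin (q1 + q2).
  rewrite g2E E1 E2 [X in Order.min _ X]addrC [X in Order.min X _]addrC.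
  by apply: min_r.
have Eaa : g2 [tuple a; a] = fin q1 + g [tuple a; c].
  by rewrite g2E E1 [X in Order.min _ X]addrC minxx.
have Ebb : g2 [tuple b; b] = fin q2 + g [tuple b; d].
  by rewrite g2E E2 [X in Order.min X _]addrC minxx addrC.
(* The diagonal sum of [g2] adds up all four corner values of [g], hence exceeds twice [q1 + q2]. A
   feasible corner [(a, c)] or [(b, d)] of [g] makes [(a, a)] or [(b, b)] feasible for [g2], so the
   loop is soft. *)
apply: (hsoft (v := (a, b))); split=> //; exists g2; split=> //.
  split=> /=; try by apply/feasP; exists (q1 + q2).
  rewrite Eab Eba Eaa Ebb; move: lt; rewrite !qinf_ltE.
  by case: (g [tuple a; c]) => [p1|]; case: (g [tuple b; d]) => [p2|] //=; lra.
case: soft => /= /feasP[q E]; [left|right]; apply/feasP.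
  by exists (q1 + q); rewrite Eaa E.
by exists (q2 + q); rewrite Ebb E.
Qed.

(** A strict inequality in either direction would be a soft edge from [(a, b)] to [(d, c)] or to
    [(c, d)]. The last hypothesis supplies softness for the first of these; the resulting inequality
    makes all four corners feasible. *)
Lemma Mbar_modular (g : wrel D 2) a b c d :
  closure G g -> a != b -> Mbar G (c, d) ->
  [tuple a; c] \in feas g -> [tuple b; d] \in feas g ->
  [tuple a; d] \in feas g \/ [tuple b; c] \in feas g ->
  [/\ [tuple a; d] \in feas g, [tuple b; c] \in feas g &
      g [tuple a; c] + g [tuple b; d] = g [tuple a; d] + g [tuple b; c]].
Proof.
move=> Cg ab Mcd Fac Fbd off; have Mdc := Mbar_sym Mcd.
have ge : g [tuple a; d] + g [tuple b; c] <= g [tuple a; c] + g [tuple b; d].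
  rewrite leNgt; apply/negP => lt.
  apply: (Mbar_no_soft_edge (v := (a, b)) Mdc); split=> //.
    exact: Mbar_neq.
  by exists g.
have [Fad Fbc] : [tuple a; d] \in feas g /\ [tuple b; c] \in feas g.
  move: ge Fac Fbd => + /feasP[q1 E1] /feasP[q2 E2]; rewrite E1 E2 !inE !lt_inftyE.
  by case: (g [tuple a; d]); case: (g [tuple b; c]).
split=> //; apply/le_anti; rewrite ge andbT leNgt; apply/negP => lt.
apply: (Mbar_no_soft_edge (v := (a, b)) Mcd); split=> //.
  exact: Mbar_neq.
by exists g; split=> //; left.
Qed.

(** * Cuts and their transport along binary relations *)

(* [bar] extended to [a = b], where it amounts to [Mbar G (a, c)]; the three
   conditions in [MJN] are instances of [cut]. *)
Definition cut a b c : Prop :=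
  [/\ a != c, b != c & exists s t, Mbar G (s, t) /\
    closure G (wrel_of_rel [set [tuple a; s]; [tuple b; s]; [tuple c; t]])].

Lemma cut_sym a b c : cut a b c -> cut b a c.
Proof.
by case=> ac bc [s [t [M C]]]; split=> //; exists s, t; rewrite (setUC [set _]).
Qed.

Lemma feas_cut (a b c s t x y : D) :
  ([tuple x; y] \in feas (wrel_of_rel
     [set [tuple a; s]; [tuple b; s]; [tuple c; t]])) =
  ((x == a) || (x == b)) && (y == s) || (x == c) && (y == t).
Proof. by rewrite feas_wrel_of_rel !inE !tuple2_eq andb_orl. Qed.

(** The composition of [phi], [{(s, t), (t, s)}] and the transpose of [phi] contains [(a, c)] and
    [(c, a)] but not [(a, a)]. *)
Lemma cut_Mbar a b c : cut a b c -> Mbar G (a, c).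
Proof.
case=> ac bc [s [t [M C]]]; have st := Mbar_neq M.
set phi := wrel_of_rel _ in C.
pose h := join false false phi (wrel_of_rel [set [tuple s; t]; [tuple t; s]]).
have Ch : closure G h by apply: closure_join C (closure_neq M).
apply: (feas_Mbar (closure_join false false Ch C) ac).
- apply/feas_join; exists t; split; last by rewrite feas_cut !eqxx orbT.
  apply/feas_join; exists s; split; first by rewrite feas_cut !eqxx.
  by rewrite feas_wrel_of_rel !inE !tuple2_eq (eqxx s) (eqxx t) orbT.
- apply/feas_join; exists s; split; last by rewrite feas_cut !eqxx.
  apply/feas_join; exists t; split; first by rewrite feas_cut !eqxx orbT.
  by rewrite feas_wrel_of_rel !inE !tuple2_eq (eqxx s) (eqxx t).
apply/negP => /feas_join[z [/feas_join[w []]]] /=.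
rewrite !feas_cut (negPf ac) !orbF => /andP[_ /eqP->].
rewrite feas_wrel_of_rel !inE !tuple2_eq (negPf st) (eqxx s) andbF andbT /=.
by move=> /eqP-> /andP[_ /eqP E]; rewrite E eqxx in st.
Qed.

Lemma cutP x y z : (x = y /\ Mbar G (y, z)) \/ bar G x y z <-> cut x y z.
Proof.
split=> [[[-> M]|]|c].
- have yz := Mbar_neq M; split=> //; exists z, y; split; first exact: Mbar_sym.
  by rewrite setUid; apply: closure_neq.
- case; rewrite /= !inE negb_or !andbT => /andP[/andP[xy xz] yz] [s [t [M C]]].
  by split=> //; exists s, t.
have [xy|xy] := eqVneq x y; first by left; split; rewrite // -xy; apply: cut_Mbar c.
case: c => xz yz E; right; split=> //.
by rewrite /= !inE negb_or xy xz yz.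
Qed.

(** Joining the two relations on their first coordinate yields [(s, s')] through [a], [(s, t')]
    through [b] and [(t, s')] through [c]. Modularity then forces [(t, t')], which would have to
    pass through both [c] and [b]. *)
Lemma cut_excl a b c : cut a b c -> cut c a b -> False.
Proof.
case=> ac bc [s [t [M C]]] [cb ab [s' [t' [M' C']]]].
have st := Mbar_neq M; have st' := Mbar_neq M'.
have Ch := closure_join true true C C'; set h := join _ _ _ _ in Ch.
have [||||/feas_join[z []]] := @Mbar_modular h t s s' t' Ch _ M'.
- by rewrite eq_sym.
- by apply/feas_join; exists c; rewrite !feas_cut !eqxx !orbT.
- by apply/feas_join; exists b; rewrite !feas_cut !eqxx !orbT.
- by right; apply/feas_join; exists a; rewrite !feas_cut !eqxx !orbT.
rewrite !feas_cut !(eq_sym t) !(eq_sym t') (negPf st) (negPf st') !eqxx.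
rewrite !andbF !andbT /= => /eqP-> /eqP E; by rewrite E eqxx in bc.
Qed.

(** The composition [k] of [h] with [phi] has second entries in [{s, t}]. If [(x, s)] is feasible
    for [k], modularity gives [y] and [z] the entry [t] as well. Otherwise modularity denies it to
    both, and [k] restricted to [x], [y], [z] witnesses the cut. *)
Lemma cut_pullback (h : wrel D 2) a b c x y z : closure G h -> cut a b c ->
  [tuple y; a] \in feas h \/ [tuple y; b] \in feas h ->
  [tuple z; a] \in feas h \/ [tuple z; b] \in feas h ->
  [tuple x; c] \in feas h ->
  cut y z x \/ [tuple y; c] \in feas h /\ [tuple z; c] \in feas h.
Proof.
move=> Ch [ac bc [s [t [M C]]]] Py Pz Px; have st := Mbar_neq M.
set phi := wrel_of_rel _ in C.
pose k := join false true h phi.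
have Ck : closure G k by apply: closure_join.
have ks q : [tuple q; s] \in feas k <->
    [tuple q; a] \in feas h \/ [tuple q; b] \in feas h.
  rewrite feas_join /=; split=> [[w []]|]; last first.
    by case=> F; [exists a|exists b]; split; rewrite // feas_cut !eqxx ?orbT.
  rewrite feas_cut (eqxx s) (negPf st) andbF andbT orbF => F /orP[]/eqP <-; by [left|right].
have kt q : [tuple q; t] \in feas k <-> [tuple q; c] \in feas h.
  rewrite feas_join /=; split=> [[w []]|F]; last first.
    by exists c; split; rewrite // feas_cut !eqxx orbT.
  by rewrite feas_cut (eqxx t) (eq_sym t) (negPf st) andbF andbT /= => F /eqP <-.
have kx q w : [tuple q; w] \in feas k -> w = s \/ w = t.
  by case/feas_join=> v [_]; rewrite feas_cut => /orP[]/andP[_ /eqP->]; [left|right].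
move/ks: Py => Py; move/ks: Pz => Pz; move/kt: Px => Px.
have swap q : [tuple q; s] \in feas k -> q != x ->
    [tuple q; t] \in feas k \/ [tuple x; s] \in feas k ->
    [tuple q; t] \in feas k /\ [tuple x; s] \in feas k.
  by move=> Pq qx off; have [] := Mbar_modular Ck qx M Pq Px off.
have [Psx|Psx] := boolP ([tuple x; s] \in feas k).
  have all q : [tuple q; s] \in feas k -> [tuple q; c] \in feas h.
    move=> Pq; apply/kt; have [->//|qx] := eqVneq q x.
    by have [] := swap q Pq qx (or_intror Psx).
  by right; split; apply: all.
have none q : [tuple q; s] \in feas k -> q != x /\ [tuple q; t] \notin feas k.
  move=> Pq; have qx : q != x by apply: contraNneq Psx => <-.
  split=> //; apply/negP => F; case/negP: Psx.
  by have [] := swap q Pq qx (or_introl F).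
have [yx Ny] := none y Py; have [zx Nz] := none z Pz.
left; split=> //; exists s, t; split=> //.
apply: (closure_wrel_of_feas (closure_restrict [set x; y; z] setT Ck)) => q w.
rewrite feas_restrict !(in_setU, in_set1, in_setT) !tuple2_eq -andb_orl andTb.
apply/andP/idP => [[xyz F]|].
  have [E|E] := kx _ _ F; rewrite E in F *; rewrite ?eqxx ?(negPf st) ?(eq_sym t) ?(negPf st).
    case/orP: xyz => [/orP[]|] /eqP E'; rewrite E' in F *.
    - by rewrite F in Psx.
    - by rewrite eqxx.
    - by rewrite eqxx orbT.
  case/orP: xyz => [/orP[]|] /eqP E'; rewrite E' in F *.
  - by rewrite eqxx orbT.
  - by rewrite F in Ny.
  - by rewrite F in Nz.
by case/orP=> [/andP[/orP[]]|/andP[]] /eqP-> /eqP->; rewrite eqxx ?orbT.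
Qed.

(** * Exchanging parts of two feasible tuples *)

Section Exchange.
Variables (r : nat) (g : wrel D r).
Hypothesis Cg : closure G g.
Implicit Types (u v w p q : r.-tuple D) (S : {set 'I_r}).

Definition between u v p : bool :=
  [forall k, (tnth p k == tnth u k) || (tnth p k == tnth v k)].

(* Coordinates leaving the box spanned by [u] and [v] are penalised by a weight
   exceeding every possible gain, so that the optimal completions of the four
   pairs of values at [i] and [j] stay inside the box. *)
Lemma box_modular u v q i j : i != j -> tnth u i != tnth v i ->
  Mbar G (tnth u j, tnth v j) -> u \in feas g -> v \in feas g -> q \in feas g ->
  tnth q i = tnth u i /\ tnth q j = tnth v j \/
  tnth q i = tnth v i /\ tnth q j = tnth u j ->
  exists p1 p2 p3 p4,
    [/\ [/\ p1 \in feas g, between u v p1, tnth p1 i = tnth u i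
          & tnth p1 j = tnth u j],
        [/\ p2 \in feas g, between u v p2, tnth p2 i = tnth v i
          & tnth p2 j = tnth v j],
        [/\ p3 \in feas g, between u v p3, tnth p3 i = tnth u i
          & tnth p3 j = tnth v j],
        [/\ p4 \in feas g, between u v p4, tnth p4 i = tnth v i
          & tnth p4 j = tnth u j]
      & g p1 + g p2 = g p3 + g p4].
Proof.
move=> ij uvi M Fu Fv Fq off.
(* The default 0 at infeasible tuples lets [m] sum over all tuples; [val] agrees with [g] at
   feasible ones. *)
pose val p : rat := odflt 0 (g p).
have valE p : p \in feas g -> g p = fin (val p).
  by rewrite /val => /feasP[x ->].
pose m := \sum_p `|val p|.
have valm p : - m <= val p <= m.
  rewrite -ler_norml /m (bigD1 p) //= lerDl; exact: sumr_ge0.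
have m0 : 0 <= m by apply: sumr_ge0.
(* The penalised values of [p1] and [p2] sum to at most [val u + val v], so to at most [2 * m]; by
   modularity so do those of [p3] and [p4]. As each value is at least [- m], every penalty is at
   most [4 * m]. *)
pose lam := 4 * m + 1.
have lam0 : 0 <= lam by rewrite /lam; lra.
pose c k x : rat := if (x == tnth u k) || (x == tnth v k) then 0 else lam.
pose pen p := \sum_k c k (tnth p k).
have c0 k x : 0 <= c k x by rewrite /c; case: ifP.
have pen0 p : 0 <= pen p by apply: sumr_ge0.
have pen_out p : ~~ between u v p -> lam <= pen p.
  rewrite negb_forall => /existsP[k Nk]; rewrite /pen (bigD1 k) //=.
  by rewrite {1}/c (negPf Nk) lerDl; apply: sumr_ge0.
have pen_in p : between u v p -> pen p = 0.
  by move=> /forallP B; apply: big1 => k _; rewrite /c B.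
have Bu : between u v u by apply/forallP => k; rewrite eqxx.
have Bv : between u v v by apply/forallP => k; rewrite eqxx orbT.
pose mu k : wrel D 1 := [ffun x => fin (c k (tnth x ord0))].
have [h Ch [hle hex]] := closure_projection (closure_weights mu Cg) ij.
have hleE p : p \in feas g ->
    h [tuple tnth p i; tnth p j] <= fin (val p + pen p).
  move=> Fp; apply: le_trans (hle p) _; rewrite ffunE valE //.
  under eq_bigr do rewrite ffunE.
  by rewrite sum_fin.
have hexE a b : [tuple a; b] \in feas h -> exists p,
    [/\ p \in feas g, tnth p i = a, tnth p j = b &
        h [tuple a; b] = fin (val p + pen p)].
  move=> /feasP[x E]; have [p [Ei Ej]] := hex _ _ _ E.
  rewrite ffunE => /qinf_add_eq_fin[x' [y [E1 + E3]]].
  under eq_bigr do rewrite ffunE.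
  rewrite sum_fin => -[E2]; have Fp : p \in feas g by apply/feasP; exists x'.
  exists p; split=> //; rewrite E -E3 -E2; congr (fin (_ + _)).
  by move: E1; rewrite (valE _ Fp) => -[].
have hfeas p : p \in feas g -> [tuple tnth p i; tnth p j] \in feas h.
  move=> Fp; rewrite inE; apply: le_lt_trans (hleE _ Fp) _.
  by rewrite qinf_ltE.
have Fuv : [tuple tnth u i; tnth v j] \in feas h \/
           [tuple tnth v i; tnth u j] \in feas h.
  by case: off => -[<- <-]; [left|right]; apply: hfeas.
have [F3 F4 E] := Mbar_modular Ch uvi M (hfeas _ Fu) (hfeas _ Fv) Fuv.
have [p1 [G1 I1 J1 E1]] := hexE _ _ (hfeas _ Fu).
have [p2 [G2 I2 J2 E2]] := hexE _ _ (hfeas _ Fv).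
have [p3 [G3 I3 J3 E3]] := hexE _ _ F3.
have [p4 [G4 I4 J4 E4]] := hexE _ _ F4.
have := hleE _ Fu; rewrite E1 (pen_in _ Bu) addr0 => L1.
have := hleE _ Fv; rewrite E2 (pen_in _ Bv) addr0 => L2.
rewrite E1 E2 E3 E4 in E.
have {}L1 : val p1 + pen p1 <= val u := L1.
have {}L2 : val p2 + pen p2 <= val v := L2.
case: E => E.
have inside p : pen p <= 4 * m -> between u v p.
  move=> le; apply: contraT => /pen_out; rewrite /lam; lra.
have := (valm u, valm v, (valm p1, valm p2, valm p3, valm p4)).
case=> [[/andP[? ?] /andP[? ?]]] [[[/andP[? ?] /andP[? ?]] /andP[? ?]] /andP[? ?]].
have := (pen0 p1, pen0 p2, pen0 p3, pen0 p4) => -[[[? ?] ?] ?].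
have B1 : between u v p1 by apply: inside; lra.
have B2 : between u v p2 by apply: inside; lra.
have B3 : between u v p3 by apply: inside; lra.
have B4 : between u v p4 by apply: inside; lra.
exists p1, p2, p3, p4; split=> //.
rewrite (valE p1) // (valE p2) // (valE p3) // (valE p4) //; congr fin.
by move: E; rewrite !pen_in // !addr0.
Qed.

Definition mix S u v : r.-tuple D :=
  [tuple if k \in S then tnth v k else tnth u k | k < r].

Lemma tnth_mix S u v k :
  tnth (mix S u v) k = if k \in S then tnth v k else tnth u k.
Proof. exact: tnth_mktuple. Qed.

(** In the second clause [q] need not lie in the box spanned by [u] and [v]; hence the condition
    passes to every [subpair], as the induction requires. *)
Definition exchangeable S u v : Prop :=
  (forall j, j \in S -> tnth u j != tnth v j -> Mbar G (tnth u j, tnth v j)) /\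
  (forall i j, i \notin S -> j \in S ->
     tnth u i != tnth v i -> tnth u j != tnth v j -> exists2 q, q \in feas g &
       tnth q i = tnth u i /\ tnth q j = tnth v j \/
       tnth q i = tnth v i /\ tnth q j = tnth u j).

Definition diffset u v : {set 'I_r} := [set k | tnth u k != tnth v k].

Definition subpair u v p q : Prop :=
  forall k, tnth p k = tnth q k \/ tnth p k = tnth u k /\ tnth q k = tnth v k.

Lemma subpair_diffset u v p q k : subpair u v p q ->
  tnth u k != tnth v k -> tnth p k = tnth q k ->
  (#|diffset p q| < #|diffset u v|)%N.
Proof.
move=> sub uvk pqk; apply: proper_card; apply/properP; split.
  by apply/subsetP => l; rewrite !inE; case: (sub l) => [->|[-> ->]]; rewrite ?eqxx.
by exists k; rewrite !inE ?pqk ?eqxx.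
Qed.

Lemma subpair_exchangeable S u v p q :
  exchangeable S u v -> subpair u v p q -> exchangeable S p q.
Proof.
move=> [H1 H2] sub; split=> [j Sj|i j Si Sj].
  by case: (sub j) => [->|[-> ->]]; [rewrite eqxx|apply: H1].
case: (sub i) => [->|[-> ->]]; first by rewrite eqxx.
by case: (sub j) => [->|[-> ->]]; [rewrite eqxx|apply: H2].
Qed.

Definition exchanges S u v : Prop :=
  [/\ mix S u v \in feas g, mix S v u \in feas g
    & g (mix S u v) + g (mix S v u) = g u + g v].

Lemma tuple_neqP u v : u != v -> exists k, tnth u k != tnth v k.
Proof.
move=> uv; apply/existsP; apply: contraNT uv; rewrite negb_exists => /forallP H.
by apply/eqP/eq_from_tnth => k; apply/eqP; rewrite -[_ == _]negbK H.
Qed.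

(* A feasible point [w] of the box spanned by [u] and [v] other than the four
   points involved splits the exchange into four exchanges at smaller distance. *)
Lemma exchange_through S u v w : w \in feas g -> between u v w ->
  w != u -> w != v -> w != mix S u v -> w != mix S v u ->
  (forall p q, subpair u v p q -> (#|diffset p q| < #|diffset u v|)%N ->
     p \in feas g -> q \in feas g -> exchanges S p q) ->
  u \in feas g -> v \in feas g -> exchanges S u v.
Proof.
move=> Fw /forallP B wu wv wu' wv' IH Fu Fv.
have {}B k : tnth w k = tnth u k \/ tnth w k = tnth v k.
  by case/orP: (B k) => /eqP; [left|right].
have uw : subpair u v u w by move=> k; case: (B k) => ->; [left|right].
have wvs : subpair u v w v by move=> k; case: (B k) => ->; [right|left].
have s13 : subpair u v (mix S u w) (mix S w v).
  by move=> k; rewrite !tnth_mix; case: (k \in S).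
have s24 : subpair u v (mix S w u) (mix S v w).
  by move=> k; rewrite !tnth_mix; case: (k \in S).
(* Each of the four inequations on [w] yields a coordinate where [u] and [v] differ but one of the
   four smaller pairs agrees. *)
have [k1 N1] := tuple_neqP wv; have [k2 N2] := tuple_neqP wu.
have [k3 N3] := tuple_neqP wv'; have [k4 N4] := tuple_neqP wu'.
have [|a1 a2 E12] := IH _ _ uw _ Fu Fw.
  by apply: (subpair_diffset uw (k := k1)); case: (B k1) N1 => ->; rewrite ?eqxx.
have [|a3 a4 E34] := IH _ _ wvs _ Fw Fv.
  by apply: (subpair_diffset wvs (k := k2)); case: (B k2) N2 => ->; rewrite ?eqxx // eq_sym.
have [|b1 b2 E13] := IH _ _ s13 _ a1 a3.
  apply: (subpair_diffset s13 (k := k3)); move: N3; rewrite !tnth_mix;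
    by case: ifP => _; case: (B k3) => ->; rewrite ?eqxx // eq_sym.
have [|b3 b4 E24] := IH _ _ s24 _ a2 a4.
  apply: (subpair_diffset s24 (k := k4)); move: N4; rewrite !tnth_mix;
    by case: ifP => _; case: (B k4) => ->; rewrite ?eqxx // eq_sym.
have M13 : mix S (mix S u w) (mix S w v) = mix S u v.
  by apply: eq_from_tnth => k; rewrite !tnth_mix; case: (k \in S).
have M31 : mix S (mix S w v) (mix S u w) = w.
  by apply: eq_from_tnth => k; rewrite !tnth_mix; case: (k \in S).
have M24 : mix S (mix S w u) (mix S v w) = w.
  by apply: eq_from_tnth => k; rewrite !tnth_mix; case: (k \in S).
have M42 : mix S (mix S v w) (mix S w u) = mix S v u.
  by apply: eq_from_tnth => k; rewrite !tnth_mix; case: (k \in S).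
rewrite M13 M31 in b1 b2 E13; rewrite M24 M42 in b3 b4 E24.
(* In the sum of the four identities the intermediate mixtures and two copies of [g w] cancel. *)
split=> //; move: E12 E34 E13 E24.
move: b1 b4 Fw Fu Fv a1 a2 a3 a4 => /feasP[? ->] /feasP[? ->] /feasP[? ->].
move=> /feasP[? ->] /feasP[? ->] /feasP[? ->] /feasP[? ->] /feasP[? ->] /feasP[? ->].
by move=> [?] [?] [?] [?]; congr fin; lra.
Qed.

(** If all differences lie on one side of [S], nothing changes up to order. If the box contains a
    further feasible point, [exchange_through] applies. Otherwise the identity of [box_modular] is
    itself the exchange. *)
Lemma exchange S u v : u \in feas g -> v \in feas g ->
  exchangeable S u v -> exchanges S u v.
Proof.
move: {2}#|_| (leqnn #|diffset u v|) => n.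
elim: n u v => [|n IH] u v le Fu Fv exch.
  have uv : u = v.
    apply: eq_from_tnth => k; apply/eqP; rewrite -[_ == _]negbK; apply/negP => N.
    by move: le; rewrite leqn0 cards_eq0 => /eqP/setP/(_ k); rewrite !inE N.
  have E : mix S v v = v by apply: eq_from_tnth => k; rewrite tnth_mix if_same.
  by rewrite uv; split; rewrite E // -uv.
have [i /andP[Si uvi]|noi] := pickP [pred i | (i \notin S) && (tnth u i != tnth v i)];
    last first.
  have E a b : (a = u /\ b = v) \/ (a = v /\ b = u) -> mix S a b = b.
    move=> ab; apply: eq_from_tnth => k; rewrite tnth_mix; case: ifP => // Sk.
    have /= := noi k; rewrite Sk /= => /negbFE/eqP.
    by case: ab => -[-> ->].
  by split; rewrite !E; try (by left); try (by right); rewrite // addrC.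
have [j /andP[Sj uvj]|noj] := pickP [pred j | (j \in S) && (tnth u j != tnth v j)];
    last first.
  have E a b : (a = u /\ b = v) \/ (a = v /\ b = u) -> mix S a b = a.
    move=> ab; apply: eq_from_tnth => k; rewrite tnth_mix; case: ifP => // Sk.
    have /= := noj k; rewrite Sk /= => /negbFE/eqP.
    by case: ab => -[-> ->].
  by split; rewrite !E; try (by left); try (by right).
have [w|none] := pickP [pred w | [&& w \in feas g, between u v w, w != u, w != v,
    w != mix S u v & w != mix S v u]].
  case/and5P=> Fw B wu wv /andP[wu' wv'].
  apply: (exchange_through Fw B) => // p q sub lt Fp Fq.
  apply: IH => //; last exact: subpair_exchangeable sub.
  by rewrite -ltnS; apply: leq_trans lt le.
have four p : p \in feas g -> between u v p ->
    [\/ p = u, p = v, p = mix S u v | p = mix S v u].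
  move=> Fp B; have /= := none p; rewrite Fp B /=.
  case: eqP => [->|_]; first by constructor 1.
  case: eqP => [->|_]; first by constructor 2.
  case: eqP => [->|_]; first by constructor 3.
  by case: eqP => [->|_] //; constructor 4.
have [H1 H2] := exch; have [q Fq off] := H2 i j Si Sj uvi uvj.
have ij : i != j by apply: contraNneq Si => ->.
have [p1 [p2 [p3 [p4 [[F1 B1 I1 J1] [F2 B2 I2 J2] [F3 B3 I3 J3] [F4 B4 I4 J4] E]]]]] :=
  box_modular ij uvi (H1 j Sj uvj) Fu Fv Fq off.
have mi a b : tnth (mix S a b) i = tnth a i by rewrite tnth_mix (negPf Si).
have mj a b : tnth (mix S a b) j = tnth b j by rewrite tnth_mix Sj.
(* The values at [i] and [j] tell the four remaining feasible points of the box apart. *)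
have P1 : p1 = u.
  case: (four p1 F1 B1) => // X; move: I1 J1; rewrite X ?mi ?mj => I1 J1.
  - by rewrite I1 eqxx in uvi.
  - by rewrite J1 eqxx in uvj.
  - by rewrite I1 eqxx in uvi.
have P2 : p2 = v.
  case: (four p2 F2 B2) => // X; move: I2 J2; rewrite X ?mi ?mj => I2 J2.
  - by rewrite I2 eqxx in uvi.
  - by rewrite I2 eqxx in uvi.
  - by rewrite J2 eqxx in uvj.
have P3 : p3 = mix S u v.
  case: (four p3 F3 B3) => // X; move: I3 J3; rewrite X ?mi ?mj => I3 J3.
  - by rewrite J3 eqxx in uvj.
  - by rewrite I3 eqxx in uvi.
  - by rewrite I3 eqxx in uvi.
have P4 : p4 = mix S v u.
  case: (four p4 F4 B4) => // X; move: I4 J4; rewrite X ?mi ?mj => I4 J4.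
  - by rewrite I4 eqxx in uvi.
  - by rewrite J4 eqxx in uvj.
  - by rewrite I4 eqxx in uvi.
by move: E F3 F4; rewrite P1 P2 P3 P4; split.
Qed.

(** * Three exchanges realising the majority and minority operations *)

Lemma cut_transfer x y z i j : i != j ->
  x \in feas g -> y \in feas g -> z \in feas g ->
  cut (tnth y j) (tnth z j) (tnth x j) ->
  cut (tnth y i) (tnth z i) (tnth x i) \/
  (exists2 q, q \in feas g & tnth q i = tnth y i /\ tnth q j = tnth x j) /\
  (exists2 q, q \in feas g & tnth q i = tnth z i /\ tnth q j = tnth x j).
Proof.
move=> ij Fx Fy Fz cj; have [h Ch [hle hex]] := closure_projection Cg ij.
have hF p : p \in feas g -> [tuple tnth p i; tnth p j] \in feas h.
  by rewrite !inE; apply: le_lt_trans (hle p).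
have Fh a b : [tuple a; b] \in feas h ->
    exists2 q, q \in feas g & tnth q i = a /\ tnth q j = b.
  by move=> /feasP[x0 /hex[q [? ? E]]]; exists q => //; apply/feasP; exists x0.
have [|[/Fh Py /Fh Pz]] := cut_pullback Ch cj (or_introl (hF _ Fy))
  (or_intror (hF _ Fz)) (hF _ Fx); by [left|right].
Qed.

(** Coordinatewise, [(x2, y2, z2)] is [(z, x, y)] on [Py], [(y, z, x)] on [Px] and [(x, y, z)]
    elsewhere: each cyclic shift is a product of two transpositions. *)
Lemma majority_exchange x y z
    (Px := [set k | `[< cut (tnth y k) (tnth z k) (tnth x k) >]])
    (Py := [set k | `[< cut (tnth z k) (tnth x k) (tnth y k) >]])
    (x1 := mix (Px :|: Py) x y) (y1 := mix (Px :|: Py) y x)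
    (x2 := mix Py x1 z) (z1 := mix Py z x1)
    (y2 := mix Px y1 z1) (z2 := mix Px z1 y1) :
  x \in feas g -> y \in feas g -> z \in feas g ->
  [/\ x2 \in feas g, y2 \in feas g, z2 \in feas g &
      g x2 + g y2 + g z2 = g x + g y + g z].
Proof.
move=> Fx Fy Fz.
have inPx k : reflect (cut (tnth y k) (tnth z k) (tnth x k)) (k \in Px).
  by rewrite inE; apply: asboolP.
have inPy k : reflect (cut (tnth z k) (tnth x k) (tnth y k)) (k \in Py).
  by rewrite inE; apply: asboolP.
have neq (S : {set 'I_r}) i j : i \notin S -> j \in S -> i != j.
  by move=> Si Sj; apply: contraNneq Si => ->.
have PxNy k : k \in Px -> k \notin Py.
  by move=> /inPx cx; apply/inPy => cy; apply: cut_excl cy cx.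
have MPx k : k \in Px -> Mbar G (tnth x k, tnth y k) /\ Mbar G (tnth x k, tnth z k).
  move=> /inPx c; split; apply: Mbar_sym; first exact: cut_Mbar c.
  exact: cut_Mbar (cut_sym c).
have MPy k : k \in Py -> Mbar G (tnth x k, tnth y k) /\ Mbar G (tnth y k, tnth z k).
  move=> /inPy c; split; first exact: cut_Mbar (cut_sym c).
  by apply: Mbar_sym; apply: cut_Mbar c.
have TPx i j : i \notin Px -> j \in Px ->
    (exists2 q, q \in feas g & tnth q i = tnth y i /\ tnth q j = tnth x j) /\
    (exists2 q, q \in feas g & tnth q i = tnth z i /\ tnth q j = tnth x j).
  move=> Si Sj; have := Sj => /inPx/(cut_transfer (neq _ _ _ Si Sj) Fx Fy Fz).
  by case=> // /inPx; rewrite (negPf Si).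
have TPy i j : i \notin Py -> j \in Py ->
    (exists2 q, q \in feas g & tnth q i = tnth z i /\ tnth q j = tnth y j) /\
    (exists2 q, q \in feas g & tnth q i = tnth x i /\ tnth q j = tnth y j).
  move=> Si Sj; have := Sj => /inPy/(cut_transfer (neq _ _ _ Si Sj) Fy Fz Fx).
  by case=> // /inPy; rewrite (negPf Si).
have [Fx1 Fy1 E1] : exchanges (Px :|: Py) x y.
  apply: exchange => //; split=> [j|i j].
    by rewrite inE => /orP[/MPx[]|/MPy[]].
  rewrite !in_setU negb_or => /andP[Nx Ny] /orP[] Sj _ _.
    by have [[q Fq E] _] := TPx _ _ Nx Sj; exists q => //; right.
  by have [_ [q Fq E]] := TPy _ _ Ny Sj; exists q => //; left.
(* On [Py] the tuple [x1] equals [y], so the pair [(z_i, y_j)] serves whatever [x1] is at [i]. *)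
have [Fx2 Fz1 E2] : exchanges Py x1 z.
  apply: exchange => //; split=> [j Sj|i j Si Sj]; rewrite !tnth_mix !in_setU Sj orbT.
    by case: (MPy _ Sj).
  by move=> _ _; have [[q Fq E] _] := TPy _ _ Si Sj; exists q => //; right.
(* Outside [Px], [z1] is [y] on [Py] and [z] elsewhere; hence both projections from [TPx] are
   needed. *)
have [Fy2 Fz2 E3] : exchanges Px y1 z1.
  apply: exchange => //; split=> [j Sj|i j Si Sj].
    rewrite !tnth_mix !in_setU Sj (negPf (PxNy _ Sj)) /=.
    by case: (MPx _ Sj).
  move=> _ _; rewrite !tnth_mix !in_setU Sj (negPf (PxNy _ Sj)) /= (negPf Si) /=.
  have [[q Fq E] [q' Fq' E']] := TPx _ _ Si Sj.
  by case: (i \in Py); [exists q|exists q'] => //; right.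
split=> //; rewrite -/x2 -/z1 in E2; rewrite -/y2 -/z2 in E3.
by rewrite -addrA E3 addrCA E2 addrA [g y1 + _]addrC E1.
Qed.

End Exchange.

(** * The operations as outcomes of the exchanges *)

Lemma MJN_cut x y z : MJN G x y z =
  if `[< cut z x y >] then (z, x, y)
  else if `[< cut y z x >] then (y, z, x) else (x, y, z).
Proof.
rewrite /MJN !(propext (cutP _ _ _)).
case: (asboolP (cut x y z)) => // cz.
case: asboolP => [cy|_]; first by case: (cut_excl cz cy).
by case: asboolP => // cx; case: (cut_excl cx cz).
Qed.

End Closure.

Theorem theorem4p16 (D : finType) (Gamma : language D)
    (hcons : conservative Gamma) (hsoft : no_soft_self_loop Gamma) :
  multimorphism
    [tuple op3 (Mj1 Gamma); op3 (Mj2 Gamma); op3 (Mn3 Gamma)] Gamma.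
Proof.
move=> r g Gg X FX.
set x := tnth X (@Ordinal 3 0 isT); set y := tnth X (@Ordinal 3 1 isT).
set z := tnth X (@Ordinal 3 2 isT).
have [] := majority_exchange hsoft (closure_base Gg) (FX _ : x \in _)
  (FX _ : y \in _) (FX _ : z \in _).
set Py := [set k | _]; set Px := [set k | _].
have op3E f : apply_op (op3 f) X = [tuple f (tnth x k) (tnth y k) (tnth z k) | k < r].
  by apply: eq_from_tnth => k; rewrite !tnth_mktuple /op3 !tnth_mktuple.
have PxNy k : k \in Px -> k \in Py -> False.
  by rewrite !inE => /asboolP cx /asboolP cy; apply: (cut_excl hsoft cy cx).
have MJNE k : MJN Gamma (tnth x k) (tnth y k) (tnth z k) =
    if k \in Py then (tnth z k, tnth x k, tnth y k)
    else if k \in Px then (tnth y k, tnth z k, tnth x k)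
    else (tnth x k, tnth y k, tnth z k).
  by rewrite (MJN_cut hsoft) !inE.
rewrite (_ : mix Py _ _ = apply_op (op3 (Mj1 Gamma)) X); last first.
  apply: eq_from_tnth => k; rewrite op3E !tnth_mix tnth_mktuple /Mj1 MJNE in_setU.
  by case: (k \in Py); case: (k \in Px).
rewrite (_ : mix Px (mix _ _ _) _ = apply_op (op3 (Mj2 Gamma)) X); last first.
  apply: eq_from_tnth => k; rewrite op3E !tnth_mix tnth_mktuple /Mj2 MJNE in_setU.
  by have := PxNy k; case: (k \in Py); case: (k \in Px) => // [[]].
rewrite (_ : mix Px _ _ = apply_op (op3 (Mn3 Gamma)) X); last first.
  apply: eq_from_tnth => k; rewrite op3E !tnth_mix tnth_mktuple /Mn3 MJNE in_setU.
  by have := PxNy k; case: (k \in Py); case: (k \in Px) => // [[]].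
move=> F1 F2 F3 E; split.
  by case=> -[|[|[|//]]] Hi.
rewrite !big_ord_recl !big_ord0 !addr0 !addrA.
have -> : g (tnth X ord0) + g (tnth X (lift ord0 ord0)) +
   g (tnth X (lift ord0 (lift ord0 ord0))) = g x + g y + g z.
  by congr (_ + _ + _); congr (g (tnth X _)); apply: val_inj.
(* The exchanges preserve the sum of values, so the inequality holds with equality. *)
by rewrite -E.
Qed.
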